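(* Let $G=(V,E)$ be a finite graph, $q\in\mathbb N$, $\beta\ge0$, let $P_{\rm SW}$ be the transition matrix of the Swendsen--Wang dynamics for the $q$-state Potts model on $G$ at inverse temperature $\beta$, let $w\in V$, and let $P_{\rm HB}^w$ be the heat-bath dynamics with the color of $w$ fixed to $1$ (defined below). Then \[ \lambda(P_{\rm SW})\;\ge\;\tilde c_{\rm SW}\,\lambda(P_{\rm HB}^w),\qquad \tilde c_{\rm SW}=\tilde c_{\rm SW}(G,\beta,q):=q^{-1}\bigl(q\,e^{2\beta}\bigr)^{-2\tilde\Delta}, \] where $\tilde\Delta=\max_{u\in V\setminus\{w\}}\deg_G(u)$.
   Context: Graphs are finite, parallel edges and loops allowed; $\deg_G(u)$ is the number of edges with endvertex $u$. Potts model: $\Omega_{\rm P}=\{1,\dots,q\}^V$, $E(\sigma)$ the set of edges whose endvertices have the same color in $\sigma$, $\pi(\sigma)=e^{\beta|E(\sigma)|}/Z$. For $A\subseteq E$, $c(A)$ is the number of connected components of $(V,A)$. Swendsen--Wang: with $p=1-e^{-\beta}$, $P_{\rm SW}(\sigma,\tau)=(1-p)^{|E(\sigma)|}\sum_{A\subseteq E(\sigma)\cap E(\tau)}\bigl(\tfrac{p}{1-p}\bigr)^{|A|}q^{-c(A)}$. Fixed-vertex model: $\Lambda_w=\{1,\dots,q\}^{V\setminus\{w\}}$; for $\bar\sigma\in\Lambda_w$ let $\bar\sigma^1\in\Omega_{\rm P}$ agree with $\bar\sigma$ on $V\setminus\{w\}$ and have $\bar\sigma^1(w)=1$; $\pi^w(\bar\sigma)=q\,\pi(\bar\sigma^1)$.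 For $v\in V\setminus\{w\}$ and $l\in\{1,\dots,q\}$, $\bar\sigma^{v,l}$ agrees with $\bar\sigma$ off $v$ and equals $l$ at $v$, and $\Omega^w_{\bar\sigma,v}=\{\bar\sigma^{v,l}:l=1,\dots,q\}$. Then $P^w_{\rm HB}(\bar\sigma,\bar\tau)=\frac{1}{|V|-1}\sum_{v\in V\setminus\{w\}}\frac{\pi^w(\bar\tau)}{\sum_{l=1}^q\pi^w(\bar\sigma^{v,l})}\mathbf 1(\bar\tau\in\Omega^w_{\bar\sigma,v})$, reversible w.r.t. $\pi^w$. Spectral gap: $\lambda(P)=1-\max\{|\xi|:\xi\text{ an eigenvalue of }P,\ \xi\neq1\}$. *)

(* Defs.v *)
From HB Require Import structures.
From mathcomp Require Import all_boot all_order all_algebra.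
From mathcomp Require Import boolp classical_sets reals.
From mathcomp Require Import sequences exp.
From mathcomp Require Import complex.
Set Implicit Arguments. Unset Strict Implicit. Unset Printing Implicit Defensive.
Import Order.TTheory GRing.Theory Num.Theory.
Local Open Scope ring_scope.
Local Open Scope classical_set_scope.

Section Potts.
Variable R : realType.
(* A finite multigraph: vertex set V, edge set E, each edge e has
   endvertices (ends e).1 and (ends e).2 (equal for a loop). *)
Variables (V E : finType) (ends : E -> V * V).

Definition deg (u : V) : nat :=
  #|[set e : E | ((ends e).1 == u) || ((ends e).2 == u)]|.

Definition adjA (A : {set E}) : rel V :=
  fun x y => [exists e in A, (ends e == (x, y)) || (ends e == (y, x))].
Definition ncomp (A : {set E}) : nat := n_comp (adjA A) [pred x : V | true].

Variable q : nat.
(* colours {1,...,q} are represented by 'I_q (colour l+1 <-> ordinal l) *)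
Definition conf := {ffun V -> 'I_q}.

Definition Emono (s : conf) : {set E} :=
  [set e : E | s (ends e).1 == s (ends e).2].

Variable beta : R.

Definition weight (s : conf) : R := expR (beta * (#|Emono s|)%:R).
Definition Zpart : R := \sum_(s : conf) weight s.
Definition piP (s : conf) : R := weight s / Zpart.

Definition pSW : R := 1 - expR (- beta).

Definition PSW (s t : conf) : R :=
  (1 - pSW) ^+ #|Emono s| *
  \sum_(A : {set E} | A \subset Emono s :&: Emono t)
     (pSW / (1 - pSW)) ^+ #|A| * (q%:R ^- ncomp A).

(* Fixed-vertex model: Lambda_w is identified with the configurations
   sigma in Omega_P with sigma(w) = c1 (c1 = colour 1); bar-sigma^1 = sigma. *)
Variables (w : V) (c1 : 'I_q).
Definition Lam := {s : conf | s w == c1}.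

Definition piw (s : conf) : R := q%:R * piP s.

Definition upd (s : conf) (v : V) (l : 'I_q) : conf :=
  [ffun u => if u == v then l else s u].

Definition inOm (s : conf) (v : V) (t : conf) : bool :=
  [exists l : 'I_q, t == upd s v l].

Definition PHB (s t : conf) : R :=
  (#|V| - 1)%:R^-1 *
  \sum_(v : V | v != w)
     (piw t / (\sum_(l : 'I_q) piw (upd s v l))) * (inOm s v t)%:R.

End Potts.

Definition mx_of (R : pzRingType) (S : finType) (P : S -> S -> R)
  : 'M[R]_#|S| := \matrix_(i, j) P (enum_val i) (enum_val j).

Definition eigenC (R : rcfType) (n : nat) (M : 'M[R]_n) (xi : R[i]) : Prop :=
  root (char_poly (map_mx (fun x : R => (x%:C)%C) M)) xi.

Definition cmod (R : rcfType) (z : R[i]) : R :=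
  let: Complex a b := z in Num.sqrt (a ^+ 2 + b ^+ 2).

(* spectral gap  lambda(P) = 1 - max{ |xi| : xi eigenvalue of P, xi <> 1 }
   (the max of the empty set is taken to be 0, via sup) *)
Definition sgap (R : realType) (n : nat) (M : 'M[R]_n) : R :=
  1 - reals.sup [set r : R | exists xi : R[i],
                   [/\ eigenC M xi, xi != 1 & r = cmod xi]].

Definition Delta_t (V : finType) (E : finType) (ends : E -> V * V) (w : V) : nat :=
  \max_(u : V | u != w) deg ends u.

Definition c_SW (R : realType) (V E : finType) (ends : E -> V * V)
  (q : nat) (beta : R) (w : V) : R :=
  q%:R^-1 * (q%:R * expR (2 * beta)) ^- (2 * Delta_t ends w).

(* Main.v *)
Require Import Defs.
From HB Require Import structures.
From mathcomp Require Import all_boot all_order all_algebra.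
From mathcomp Require Import boolp classical_sets reals.
From mathcomp Require Import sequences exp.
From mathcomp Require Import complex.
From mathcomp Require Import ring lra.
From mathcomp Require Import fintype finset perm.
Set Implicit Arguments. Unset Strict Implicit. Unset Printing Implicit Defensive.
Import Order.TTheory GRing.Theory Num.Theory.
Local Open Scope ring_scope.

(* The Swendsen-Wang matrix depends on configurations only through their sets
   of monochromatic edges, so its eigenfunctions with nonzero eigenvalue are
   invariant under permutations of the colours, and those eigenvalues are
   eigenvalues of the chain K(s, t) = q P_SW(s, t) on configurations with
   s(w) = 1.  Let H be the fixed-vertex heat bath and C = (q e^(2 beta))^(2 D),
   D the maximal degree off w.  Recolouring one vertex in each argument changes
   the density K(s, t) / pi(t) by at most the factor C: the cluster sum over
   A included in E(s) and E(t) gains at most q e^beta per additional edge,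
   because adding an edge to A removes at most one component, and the two
   weights change by at most e^(beta D) each.  Hence H K H <= C K pointwise, so
   K = C^-1 H K H + (a symmetric positive remainder of row sum 1 - C^-1), and on
   functions of mean zero |<f, K f>| <= C^-1 |H f|^2 + (1 - C^-1) |f|^2, where
   |H f| <= (1 - gap H) |f| by the spectral theorem. *)

(** * Reversible kernels and their spectral gap *)

Local Open Scope complex_scope.

Lemma norm_cmod (R : rcfType) (z : R[i]) : `|z| = (cmod z)%:C.
Proof. by case: z => a b; rewrite normc_def. Qed.

Lemma cmod_ge0 (R : rcfType) (z : R[i]) : 0 <= cmod z.
Proof. by case: z => a b; rewrite sqrtr_ge0. Qed.

Lemma cmod_real (R : rcfType) (x : R) : cmod x%:C = `|x|.
Proof. by rewrite /cmod /= expr0n addr0 sqrtr_sqr. Qed.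

Lemma dotmx_sum (R : rcfType) n (u : 'rV[R[i]]_n) :
  dotmx u u = \sum_i `|u 0 i| ^+ 2.
Proof.
rewrite dotmxE mxE; apply: eq_bigr => i _.
by rewrite !mxE normCK.
Qed.

(** A real symmetric matrix is normal over the complex numbers, so a unitary [P] diagonalises it;
    [P] preserves norms, and each diagonal entry is an eigenvalue, of modulus at most [m]. *)
Lemma symmetric_contraction (R : rcfType) n (A : 'M[R]_n) (m : R) :
  A^T = A -> 0 <= m ->
  (forall z : R[i], eigenC A z -> cmod z <= m) ->
  forall v : 'rV[R]_n,
    \sum_i (v *m A) 0 i ^+ 2 <= m ^+ 2 * \sum_i v 0 i ^+ 2.
Proof.
move=> Asym m0 Am v.
set AC := map_mx (fun x : R => x%:C) A.
have ACn : AC \is normalmx.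
  have E : map_mx (@Num.conj _) AC^T = AC.
    apply/matrixP => i j; rewrite !mxE -[in RHS]Asym mxE.
    by apply/CrealP; rewrite complex_real.
  by apply/normalmxP; rewrite E.
have /orthomx_spectralP ACE := ACn.
set P := spectralmx AC in ACE; set d := spectral_diag AC in ACE.
have PU : P \is unitarymx by exact: spectral_unitarymx.
have Pu : P \in unitmx by exact: spectral_unit.
have deig i : cmod (d 0 i) <= m.
  apply: Am; rewrite /eigenC -eigenvalue_root_char -/AC.
  apply/eigenvalueP; exists (row i P).
    rewrite {1}ACE !mulmxA -row_mul mulmxV // row1 -rowE row_diag_mx.
    by rewrite -scalemxAl -rowE.
  apply/negP => /eqP /(congr1 (mulmx^~ (invmx P))).
  rewrite -row_mul mulmxV // mul0mx row1 => /rowP/(_ i).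
  by rewrite !mxE !eqxx => /eqP; rewrite oner_eq0.
pose vC := map_mx (fun x : R => x%:C) v.
have vAC : vC *m AC = map_mx (fun x : R => x%:C) (v *m A).
  by rewrite /vC /AC (map_mxM (real_complex R)).
have realsum (u : 'rV[R]_n) :
  dotmx (map_mx (fun x : R => x%:C) u) (map_mx (fun x : R => x%:C) u)
   = (\sum_i u 0 i ^+ 2)%:C.
  rewrite dotmx_sum rmorph_sum; apply: eq_bigr => i _.
  by rewrite mxE norm_cmod cmod_real -rmorphXn /= real_normK ?num_real.
have dotU (u : 'rV[R[i]]_n) : dotmx (u *m P) (u *m P) = dotmx u u.
  by rewrite !dotmxE trmx_mul map_mxM mulmxA mulmxtVK.
pose w := vC *m invmx P.
have Ev : vC = w *m P by rewrite /w mulmxKV.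
rewrite -lecR rmorphM /= -!realsum -vAC -/vC ACE !mulmxA dotU -/w.
rewrite Ev dotU !dotmx_sum mulr_sumr; apply: ler_sum => i _.
rewrite mul_mx_diag mxE normrM exprMn mulrC.
apply: ler_wpM2r; first by rewrite exprn_ge0.
by rewrite rmorphXn /= norm_cmod -!rmorphXn /= lecR ler_pXn2r // nnegrE cmod_ge0.
Qed.

Definition kernel_app (R : pzRingType) (S : finType) (K : S -> S -> R)
  (f : S -> R) (s : S) : R :=
  \sum_t K s t * f t.

Lemma sum_enum_val (R : nmodType) (S : finType) (F : S -> R) :
  \sum_(i < #|S|) F (enum_val i) = \sum_s F s.
Proof. by rewrite [RHS](reindex _ (onW_bij _ (@enum_val_bij S))). Qed.

Lemma ReM (R : rcfType) (x y : R[i]) :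
  complex.Re (x * y) = complex.Re x * complex.Re y - complex.Im x * complex.Im y.
Proof. by case: x => ? ?; case: y. Qed.

Lemma ImM (R : rcfType) (x y : R[i]) :
  complex.Im (x * y) = complex.Re x * complex.Im y + complex.Im x * complex.Re y.
Proof. by case: x => ? ?; case: y. Qed.

Lemma Re_sum (R : rcfType) (I : finType) (F : I -> R[i]) :
  complex.Re (\sum_i F i) = \sum_i complex.Re (F i).
Proof. by apply: (big_morph (@complex.Re R)) => // -[? ?] [? ?]. Qed.

Lemma Im_sum (R : rcfType) (I : finType) (F : I -> R[i]) :
  complex.Im (\sum_i F i) = \sum_i complex.Im (F i).
Proof. by apply: (big_morph (@complex.Im R)) => // -[? ?] [? ?]. Qed.

Section Reversible.
Variables (R : rcfType) (S : finType) (mu : S -> R) (K : S -> S -> R).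
Hypothesis mu_gt0 : forall s, 0 < mu s.
Hypothesis rev : forall s t, mu s * K s t = mu t * K t s.

Lemma reversible_density s t : K s t / mu t = K t s / mu s.
Proof.
by apply/eqP; rewrite eqr_div ?lt0r_neq0 // mulrC rev mulrC.
Qed.

Lemma kernel_app_adjoint (f g : S -> R) :
  \sum_s mu s * (g s * kernel_app K f s) = \sum_s mu s * (f s * kernel_app K g s).
Proof.
rewrite /kernel_app.
under eq_bigr => s _ do rewrite mulrA mulr_sumr.
under [RHS]eq_bigr => s _ do rewrite mulrA mulr_sumr.
rewrite exchange_big /=; apply: eq_bigr => t _; apply: eq_bigr => s _.
transitivity (mu s * K s t * (f t * g s)); first by ring.
by rewrite rev; ring.
Qed.

Lemma weighted_sqr_gt0 (f : S -> R) :
  (exists s, f s != 0) -> 0 < \sum_s mu s * f s ^+ 2.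
Proof.
case=> s fs; rewrite (bigD1 s) //= ltr_pwDl //.
  by rewrite mulr_gt0 // exprn_even_gt0.
by apply: sumr_ge0 => t _; rewrite mulr_ge0 ?sqr_ge0 // ltW.
Qed.

(** Dividing a left eigenvector by [mu] gives an eigenfunction [g]. Self-adjointness, applied to its
    real and imaginary parts [a] and [b], makes [xi] real; whichever of [a], [b] is nonzero is then
    a real eigenfunction. *)
Lemma reversible_eigenC_real (xi : R[i]) : eigenC (mx_of K) xi ->
  exists x f, [/\ xi = x%:C, exists s, f s != 0 & forall s, kernel_app K f s = x * f s].
Proof.
rewrite /eigenC -eigenvalue_root_char => /eigenvalueP [v vE v0].
pose g s := v 0 (enum_rank s) * ((mu s)^-1)%:C.
have gE t : \sum_s (K t s)%:C * g s = xi * g t.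
  have /rowP/(_ (enum_rank t)) := vE; rewrite !mxE => E.
  rewrite /g mulrA -E mulr_suml -sum_enum_val; apply: eq_bigr => i _.
  rewrite !mxE enum_valK enum_rankK mulrCA -!mulrA; congr (_ * _).
  rewrite -!rmorphM /=; congr (_%:C).
  exact: reversible_density.
pose a s := complex.Re (g s); pose b s := complex.Im (g s).
have aE t : kernel_app K a t = complex.Re xi * a t - complex.Im xi * b t.
  rewrite -ReM -gE Re_sum; apply: eq_bigr => s _.
  by rewrite ReM /= mul0r subr0.
have bE t : kernel_app K b t = complex.Re xi * b t + complex.Im xi * a t.
  rewrite -ImM -gE Im_sum; apply: eq_bigr => s _.
  by rewrite ImM /= mul0r addr0.
have [s gs] : exists s, g s != 0.
  have /rV0Pn[i vi] := v0; exists (enum_val i).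
  rewrite /g enum_valK mulf_neq0 // fmorph_eq0 invr_eq0.
  by rewrite lt0r_neq0.
have ab : a s != 0 \/ b s != 0.
  move: gs; rewrite /a /b; case: (g s) => u w; rewrite eq_complex /= negb_and.
  by move/orP.
have y0 : complex.Im xi = 0.
  have := kernel_app_adjoint a b; under eq_bigr => u _ do rewrite aE.
  under [RHS]eq_bigr => u _ do rewrite bE.
  move=> E.
  have {}E : complex.Im xi * (\sum_s mu s * a s ^+ 2 + \sum_s mu s * b s ^+ 2) = 0.
    rewrite -big_split mulr_sumr /=; transitivity
     (\sum_i mu i * (a i * (complex.Re xi * b i + complex.Im xi * a i)) -
      \sum_i mu i * (b i * (complex.Re xi * a i - complex.Im xi * b i))).
      by rewrite -sumrB; apply: eq_bigr => u _; ring.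
    by rewrite E subrr.
  apply/eqP; move/eqP: E; rewrite mulf_eq0 => /orP [//|].
  have ge0 (h : S -> R) : 0 <= \sum_s mu s * h s ^+ 2.
    by apply: sumr_ge0 => u _; rewrite mulr_ge0 ?sqr_ge0 // ltW.
  rewrite paddr_eq0 // => /andP [/eqP A /eqP B].
  case: ab => h.
    by have := @weighted_sqr_gt0 a (ex_intro _ s h); rewrite A ltxx.
  by have := @weighted_sqr_gt0 b (ex_intro _ s h); rewrite B ltxx.
have xE : xi = (complex.Re xi)%:C.
  by apply/eqP; rewrite eq_complex /= y0 !eqxx.
exists (complex.Re xi); case: ab => h; [exists a | exists b]; split=> //.
- by exists s.
- by move=> t; rewrite aE y0 mul0r subr0.
- by exists s.
- by move=> t; rewrite bE y0 mul0r addr0.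
Qed.

Lemma reversible_eigenfunction_eigenC (x : R) (f : S -> R) :
  (exists s, f s != 0) -> (forall s, kernel_app K f s = x * f s) ->
  eigenC (mx_of K) x%:C.
Proof.
case=> s fs fE; rewrite /eigenC -eigenvalue_root_char; apply/eigenvalueP.
exists (\row_i (mu (enum_val i) * f (enum_val i))%:C).
  apply/rowP => j; rewrite !mxE -rmorphM /=.
  under eq_bigr => i _ do rewrite !mxE -rmorphM.
  rewrite -rmorph_sum /=; congr (_%:C).
  rewrite (sum_enum_val (fun u => mu u * f u * K u (enum_val j))).
  rewrite mulrCA -fE mulr_sumr; apply: eq_bigr => u _.
  by rewrite mulrAC rev; ring.
apply/rV0Pn; exists (enum_rank s); rewrite mxE enum_rankK fmorph_eq0.
by rewrite mulf_neq0 // lt0r_neq0.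
Qed.

End Reversible.

(* Conjugating by [sqrt mu] turns a [mu]-reversible kernel into a symmetric one. *)
Lemma reversible_contraction (R : rcfType) (S : finType) (mu : S -> R)
  (K : S -> S -> R) (m : R) :
  (forall s, 0 < mu s) -> (forall s t, mu s * K s t = mu t * K t s) ->
  0 <= m ->
  (forall x f, (exists s, f s != 0) -> (forall s, kernel_app K f s = x * f s) ->
     `|x| <= m) ->
  forall f, \sum_s mu s * kernel_app K f s ^+ 2 <= m ^+ 2 * \sum_s mu s * f s ^+ 2.
Proof.
move=> mu_gt0 rev m0 Hm f.
pose r s := Num.sqrt (mu s).
have r_gt0 s : 0 < r s by rewrite sqrtr_gt0.
have r2 s : r s * r s = mu s by rewrite -expr2 sqr_sqrtr // ltW.
pose K' s t := r s * K s t / r t.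
have K'sym s t : K' s t = K' t s.
  have := rev s t; rewrite /K' -!r2.
  have := r_gt0 s; have := r_gt0 t.
  move: (r s) (r t) (K s t) (K t s) => a b c d b0 a0 E.
  apply: (mulfI (lt0r_neq0 a0)); apply: (mulfI (lt0r_neq0 b0)).
  have -> : b * (a * (a * c / b)) = a * a * c by field; rewrite lt0r_neq0.
  by rewrite E; field; rewrite lt0r_neq0.
(* [K'] is reversible for the constant weight 1, and its eigenfunctions divided by [r] are
   eigenfunctions of [K]. *)
have K'eig z : eigenC (mx_of K') z -> cmod z <= m.
  move/(@reversible_eigenC_real _ _ (fun=> 1)) => [||x [g [-> [s gs] gE]]].
  - by move=> ?; exact: ltr01.
  - by move=> s t; rewrite K'sym.
  rewrite cmod_real; apply: (Hm _ (fun s => g s / r s)).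
    by exists s; rewrite mulf_neq0 // invr_eq0 lt0r_neq0.
  move=> t; rewrite mulrA -gE /kernel_app mulr_suml; apply: eq_bigr => u _.
  by rewrite /K'; field; rewrite !lt0r_neq0.
have sym : (mx_of K')^T = mx_of K' by apply/matrixP => i j; rewrite !mxE K'sym.
have := @symmetric_contraction _ _ _ _ sym m0 K'eig
  (\row_i (r (enum_val i) * f (enum_val i))).
congr (_ <= _ * _).
  rewrite -[RHS]sum_enum_val; apply: eq_bigr => i _; rewrite mxE.
  under eq_bigr => j _ do rewrite !mxE K'sym.
  rewrite (sum_enum_val (fun u => r u * f u * K' (enum_val i) u)).
  rewrite -r2 -expr2 -exprMn; congr (_ ^+ 2).
  rewrite /kernel_app mulr_sumr; apply: eq_bigr => u _.
  by rewrite /K'; field; rewrite lt0r_neq0.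
rewrite -[RHS]sum_enum_val; apply: eq_bigr => i _; rewrite mxE.
by rewrite exprMn expr2 r2.
Qed.

(** Termwise [|f s * f t| <= (f s ^+ 2 + f t ^+ 2) / 2], and by symmetry of [M] both squares
    contribute the same sum. *)
Lemma symmetric_form_bound (R : realFieldType) (S : finType)
    (M : S -> S -> R) (f : S -> R) :
  (forall s t, 0 <= M s t) -> (forall s t, M s t = M t s) ->
  `|\sum_s \sum_t M s t * (f s * f t)| <= \sum_s (\sum_t M s t) * f s ^+ 2.
Proof.
move=> M0 Ms.
apply: (@le_trans _ _ (\sum_s \sum_t M s t * ((f s ^+ 2 + f t ^+ 2) / 2))).
  apply: (le_trans (ler_norm_sum _ _ _)); apply: ler_sum => s _.
  apply: (le_trans (ler_norm_sum _ _ _)); apply: ler_sum => t _.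
  rewrite normrM ger0_norm //; apply: ler_wpM2l => //.
  rewrite ler_norml; have := sqr_ge0 (f s - f t); have := sqr_ge0 (f s + f t).
  by move=> *; apply/andP; split; lra.
have E : \sum_s \sum_t M s t * f t ^+ 2 = \sum_s (\sum_t M s t) * f s ^+ 2.
  rewrite exchange_big; apply: eq_bigr => s _ /=; rewrite mulr_suml.
  by apply: eq_bigr => t _; rewrite Ms.
have -> : \sum_s \sum_t M s t * ((f s ^+ 2 + f t ^+ 2) / 2) =
   (\sum_s (\sum_t M s t) * f s ^+ 2 + \sum_s \sum_t M s t * f t ^+ 2) / 2.
  rewrite -big_split mulr_suml; apply: eq_bigr => s _ /=.
  rewrite mulr_suml -big_split mulr_suml; apply: eq_bigr => t _ /=.
  by field.
by rewrite E; set u := \sum_s _; lra.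
Qed.

(** * Spectral gap and comparison of stochastic reversible kernels *)

Section Gap.
Variables (R : realType) (S : finType) (mu : S -> R).
Hypothesis mu_gt0 : forall s, 0 < mu s.

Definition stochastic (K : S -> S -> R) :=
  (forall s t, 0 <= K s t) /\ (forall s, \sum_t K s t = 1).
Definition reversible (K : S -> S -> R) :=
  forall s t, mu s * K s t = mu t * K t s.

Lemma form_kernel_app (K : S -> S -> R) (f : S -> R) :
  \sum_s \sum_t mu s * K s t * (f s * f t) = \sum_s mu s * (f s * kernel_app K f s).
Proof.
apply: eq_bigr => s _; rewrite /kernel_app !mulr_sumr; apply: eq_bigr => t _.
by ring.
Qed.

Lemma stochastic_form_bound (K : S -> S -> R) (f : S -> R) :
  stochastic K -> reversible K ->
  `|\sum_s mu s * (f s * kernel_app K f s)| <= \sum_s mu s * f s ^+ 2.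
Proof.
move=> [K0 K1] Kr; rewrite -form_kernel_app.
apply: (le_trans (@symmetric_form_bound _ _ _ f _ _)) => //.
  by move=> s t; rewrite mulr_ge0 // ltW.
rewrite le_eqVlt; apply/orP; left; apply/eqP; apply: eq_bigr => s _.
by rewrite -mulr_sumr K1 mulr1.
Qed.

Lemma form_eigen (K : S -> S -> R) (f : S -> R) x :
  (forall s, kernel_app K f s = x * f s) ->
  \sum_s mu s * (f s * kernel_app K f s) = x * \sum_s mu s * f s ^+ 2.
Proof.
by move=> E; rewrite mulr_sumr; apply: eq_bigr => s _; rewrite E; ring.
Qed.

Lemma stochastic_eigen_le1 (K : S -> S -> R) (f : S -> R) x :
  stochastic K -> reversible K ->
  (exists s, f s != 0) -> (forall s, kernel_app K f s = x * f s) -> `|x| <= 1.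
Proof.
move=> Ks Kr f0 E; have := stochastic_form_bound f Ks Kr; rewrite (form_eigen E).
have N0 := weighted_sqr_gt0 mu_gt0 f0.
by rewrite normrM (gtr0_norm N0) ger_pMl.
Qed.

(** Moduli are nonnegative, and [sup] takes the value 0 on a set without supremum. *)
Lemma sgap_le1 n (A : 'M[R]_n) : sgap A <= 1.
Proof.
rewrite /sgap lerBlDr lerDl.
set X := (X in sup X).
have [[[r Xr] ub]|] := pselect (has_sup X); last by move/sup_out->.
apply: (le_trans _ (ub_le_sup ub Xr)).
by case: Xr => xi [_ _ ->]; exact: cmod_ge0.
Qed.

(** The assumption [c <= 1] settles the case of no eigenvalue other than 1, where the supremum is 0
    by convention. *)
Lemma sgap_geP n (A : 'M[R]_n) (c : R) : c <= 1 ->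
  (forall xi, eigenC A xi -> xi != 1 -> cmod xi <= 1 - c) -> c <= sgap A.
Proof.
move=> c1 H; rewrite /sgap lerBrDr -lerBrDl.
set X := (X in sup X).
have [X0|] := pselect (X !=set0)%classic.
  by apply: ge_sup => // _ [xi [e x1 ->]]; exact: H.
by move=> X0; rewrite sup_out ?subr_ge0 // => -[].
Qed.

Lemma eigen_le_sgap (K : S -> S -> R) (f : S -> R) x :
  stochastic K -> reversible K ->
  (exists s, f s != 0) -> (forall s, kernel_app K f s = x * f s) -> x != 1 ->
  `|x| <= 1 - sgap (mx_of K).
Proof.
move=> Ks Kr f0 E x1; rewrite /sgap opprB addrC subrK; apply: ub_le_sup.
  exists 1 => _ [xi [e _ ->]].
  have [y [g [-> g0 gE]]] := reversible_eigenC_real mu_gt0 Kr e.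
  by rewrite cmod_real; apply: (stochastic_eigen_le1 Ks Kr g0 gE).
exists x%:C; split; last by rewrite cmod_real.
  exact: (reversible_eigenfunction_eigenC mu_gt0 Kr f0 E).
by apply: contra x1 => /eqP [->].
Qed.

(** [sgap] discards the eigenvalue 1 whatever its multiplicity; harmonic functions being constant is
    what lets it control all functions of mean zero. *)
Lemma sgap_contraction (H : S -> S -> R) (f : S -> R) :
  stochastic H -> reversible H ->
  (forall g, (forall s, kernel_app H g s = g s) -> forall s t, g s = g t) ->
  \sum_s mu s * f s = 0 ->
  \sum_s mu s * kernel_app H f s ^+ 2
    <= (1 - sgap (mx_of H)) ^+ 2 * \sum_s mu s * f s ^+ 2.
Proof.
move=> Hs Hr Hirr f_mean.
pose Z := \sum_s mu s.
(* Subtracting the stationary projection removes the eigenvalue 1. *)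
pose K s t := H s t - mu t / Z.
have appK g s : kernel_app K g s = kernel_app H g s - (\sum_t mu t * g t) / Z.
  rewrite /kernel_app mulr_suml -sumrB; apply: eq_bigr => t _.
  by rewrite /K; ring.
have sumH g : \sum_s mu s * kernel_app H g s = \sum_s mu s * g s.
  have := kernel_app_adjoint Hr g (fun=> 1).
  under eq_bigr => s _ do rewrite mul1r.
  move=> ->; apply: eq_bigr => s _; congr (_ * _).
  rewrite /kernel_app; under eq_bigr => t _ do rewrite mulr1.
  by rewrite Hs.2 mulr1.
have := @reversible_contraction _ _ mu K (1 - sgap (mx_of H)) mu_gt0 _ _ _ f.
have -> : \sum_s mu s * kernel_app K f s ^+ 2 = \sum_s mu s * kernel_app H f s ^+ 2.
  by apply: eq_bigr => s _; rewrite appK f_mean mul0r subr0.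
apply.
- by move=> s t; rewrite /K !mulrBr Hr; congr (_ - _); ring.
- by rewrite subr_ge0 sgap_le1.
move=> x g [s gs] gE.
have Z0 : Z != 0.
  by rewrite lt0r_neq0 // /Z (bigD1 s) //= ltr_pwDl // sumr_ge0 // => *; exact: ltW.
have [->|x0] := eqVneq x 0; first by rewrite normr0 subr_ge0 sgap_le1.
(* The image of [K] has mean zero, and [g] lies in it because [x] is nonzero. *)
have g_mean : \sum_s mu s * g s = 0.
  apply: (mulfI x0); rewrite mulr0 mulr_sumr.
  under eq_bigr => t _ do rewrite mulrCA -gE appK mulrBr.
  rewrite sumrB sumH -mulr_suml -/Z mulrC divfK // subrr //.
apply: (@eigen_le_sgap H g) => //; first by exists s.
  by move=> t; rewrite -gE appK g_mean mul0r subr0.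
(* For [x = 1] the function [g] would be harmonic for [H], hence constant, and being of mean zero it
   would vanish. *)
apply: contra gs => /eqP x1.
have gc := Hirr g _ s.
rewrite -(mulrI_eq0 _ (mulfI Z0)) /Z mulr_suml -[X in _ == X]g_mean.
apply/eqP; apply: eq_bigr => t _; rewrite -gc // => u.
by have := gE u; rewrite appK g_mean x1 mul0r subr0 mul1r.
Qed.

(* [K s' t' / mu t'] is the density of [K] with respect to [mu]; the hypothesis
   says that moving both arguments by [H] changes it at most by the factor [C],
   so that [H K H <= C K] pointwise. *)
Lemma comparison (H K : S -> S -> R) (C : R) (f : S -> R) (x : R) :
  stochastic H -> reversible H -> stochastic K -> reversible K ->
  (forall g, (forall s, kernel_app H g s = g s) -> forall s t, g s = g t) ->
  1 <= C ->
  (forall s s' t t', H s s' != 0 -> H t t' != 0 ->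
     K s' t' / mu t' <= C * (K s t / mu t)) ->
  (exists s, f s != 0) -> \sum_s mu s * f s = 0 ->
  (forall s, kernel_app K f s = x * f s) ->
  `|x| <= 1 - C^-1 * sgap (mx_of H).
Proof.
move=> Hs Hr Ks Kr Hirr C1 HK f0 f_mean fE.
have C0 : 0 < C by exact: lt_le_trans C1.
pose k s t := K s t / mu t.
have ksym s t : k s t = k t s.
  exact: reversible_density.
have k0 s t : 0 <= k s t by rewrite divr_ge0 ?Ks.1 // ltW.
have muk s t : mu t * k s t = K s t.
  by rewrite /k mulrC divfK // lt0r_neq0.
(* By reversibility [W s t] is [mu s] times the entry of the product H K H at [(s, t)], written so
   that its symmetry shows. *)
pose W s t := \sum_s' \sum_t' (mu s * H s s') * (mu t * H t t') * k s' t'.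
have Wsym s t : W s t = W t s.
  rewrite /W exchange_big; apply: eq_bigr => s' _; apply: eq_bigr => t' _ /=.
  by rewrite ksym; ring.
have WleK s t : W s t <= C * (mu s * K s t).
  apply: (@le_trans _ _ (\sum_s' \sum_t'
     (mu s * H s s') * (mu t * H t t') * (C * k s t))).
    apply: ler_sum => s' _; apply: ler_sum => t' _.
    have [->|hs] := eqVneq (H s s') 0; first by rewrite !(mulr0, mul0r).
    have [->|ht] := eqVneq (H t t') 0; first by rewrite !(mulr0, mul0r).
    apply: ler_wpM2l; last exact: HK.
    by rewrite !mulr_ge0 ?Hs.1 // ltW.
  rewrite le_eqVlt; apply/orP; left; apply/eqP.
  under eq_bigr => s' _ do rewrite -mulr_suml -mulr_sumr -mulr_sumr Hs.2 mulr1.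
  rewrite -!mulr_suml -mulr_sumr Hs.2 mulr1 -muk; ring.
have Wrow s : \sum_t W s t = mu s.
  rewrite /W exchange_big /=.
  transitivity (\sum_s' mu s * H s s'); last by rewrite -mulr_sumr Hs.2 mulr1.
  apply: eq_bigr => s' _; rewrite exchange_big /=.
  transitivity (\sum_t' (mu s * H s s') * K s' t').
    apply: eq_bigr => t' _; rewrite -mulr_suml -mulr_sumr -mulrA; congr (_ * _).
    rewrite -[in RHS]muk; congr (_ * _).
    under eq_bigr => t _ do rewrite Hr.
    by rewrite -mulr_sumr Hs.2 mulr1.
  by rewrite -mulr_sumr Ks.2 mulr1.
have Wform : \sum_s \sum_t W s t * (f s * f t) =
    \sum_s mu s * (kernel_app H f s * kernel_app K (kernel_app H f) s).
  have appH s : \sum_u mu u * H u s * f u = mu s * kernel_app H f s.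
    by rewrite /kernel_app mulr_sumr; apply: eq_bigr => u _; rewrite Hr mulrA.
  transitivity (\sum_s' \sum_t' (\sum_s mu s * H s s' * f s) *
      (\sum_t mu t * H t t' * f t) * k s' t').
    transitivity (\sum_s \sum_t \sum_s' \sum_t'
       (mu s * H s s' * f s) * (mu t * H t t' * f t) * k s' t').
      apply: eq_bigr => s _; apply: eq_bigr => t _; rewrite mulr_suml.
      apply: eq_bigr => s' _; rewrite mulr_suml; apply: eq_bigr => t' _; ring.
    under eq_bigr => s _ do rewrite exchange_big.
    rewrite exchange_big; apply: eq_bigr => s' _ /=.
    under eq_bigr => s _ do rewrite exchange_big.
    rewrite exchange_big; apply: eq_bigr => t' _ /=.
    rewrite mulr_suml mulr_suml; apply: eq_bigr => s _.
    by rewrite mulr_sumr mulr_suml.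
  rewrite -form_kernel_app; apply: eq_bigr => s _; apply: eq_bigr => t _.
  rewrite !appH -muk; ring.
pose N := \sum_s mu s * f s ^+ 2.
have N0 : 0 < N by exact: weighted_sqr_gt0.
pose m := 1 - sgap (mx_of H).
have m0 : 0 <= m by rewrite subr_ge0 sgap_le1.
(* The form of [W] at [f] is the form of [K] at [kernel_app H f]; here the gap of [H] enters. *)
have b1 : `|\sum_s \sum_t W s t * (f s * f t)| <= m ^+ 2 * N.
  rewrite Wform; apply: (le_trans (stochastic_form_bound _ Ks Kr)).
  exact: sgap_contraction.
have b2 : `|\sum_s \sum_t (mu s * K s t - C^-1 * W s t) * (f s * f t)|
    <= (1 - C^-1) * N.
  apply: (le_trans (@symmetric_form_bound _ _ _ f _ _)).
  - by move=> s t; rewrite subr_ge0 ler_pdivrMl.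
  - by move=> s t; rewrite Kr Wsym.
  rewrite le_eqVlt; apply/orP; left; apply/eqP; rewrite /N mulr_sumr.
  apply: eq_bigr => s _; rewrite sumrB -!mulr_sumr Wrow Ks.2; ring.
have xN : x * N = \sum_s \sum_t (mu s * K s t - C^-1 * W s t) * (f s * f t)
     + C^-1 * \sum_s \sum_t W s t * (f s * f t).
  rewrite -(form_eigen fE) -form_kernel_app mulr_sumr -big_split.
  apply: eq_bigr => s _ /=; rewrite mulr_sumr -big_split; apply: eq_bigr => t _ /=; ring.
have Ci0 : 0 <= C^-1 by rewrite invr_ge0 ltW.
have b3 : `|x| * N <= (1 - C^-1) * N + C^-1 * (m ^+ 2 * N).
  rewrite -[X in _ * X <= _](gtr0_norm N0) -normrM xN.
  apply: (le_trans (ler_normD _ _)); apply: lerD => //.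
  by rewrite normrM (ger0_norm Ci0); apply: ler_wpM2l.
have {b3} b4 : `|x| <= 1 - C^-1 * (1 - m ^+ 2).
  by rewrite -(ler_pM2r N0); apply: (le_trans b3);
    rewrite le_eqVlt; apply/orP; left; apply/eqP; ring.
have -> : sgap (mx_of H) = 1 - m by rewrite /m opprB addrC subrK.
(* For [m <= 1] one has [m ^+ 2 <= m]; for [m > 1] the target is at least 1, so [|x| <= 1]
   suffices. *)
have [m1|m1] := leP m 1.
  apply: (le_trans b4); rewrite lerD2l lerN2; apply: ler_wpM2l => //.
  by rewrite lerD2l lerN2 expr2 ler_piMl.
apply: (le_trans (stochastic_eigen_le1 Ks Kr f0 fE)).
rewrite lerDl oppr_ge0; apply: mulr_ge0_le0 => //; lra.
Qed.

(** The Dirichlet form vanishes at a harmonic function, while its terms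
    [mu s * H s t * (g s - g t) ^+ 2] are all nonnegative. *)
Lemma harmonic_constant_along (H : S -> S -> R) (g : S -> R) :
  stochastic H -> reversible H -> (forall s, kernel_app H g s = g s) ->
  forall s t, H s t != 0 -> g s = g t.
Proof.
move=> Hs Hr gE.
have E1 : \sum_s \sum_t mu s * H s t * g s ^+ 2 = \sum_s mu s * g s ^+ 2.
  by apply: eq_bigr => s _; rewrite -mulr_suml -mulr_sumr Hs.2 mulr1.
have E2 : \sum_s \sum_t mu s * H s t * g t ^+ 2 = \sum_s mu s * g s ^+ 2.
  rewrite -E1 exchange_big; apply: eq_bigr => s _; apply: eq_bigr => t _ /=.
  by rewrite Hr.
have E3 : \sum_s \sum_t mu s * H s t * (g s * g t) = \sum_s mu s * g s ^+ 2.
  by rewrite form_kernel_app; apply: eq_bigr => s _; rewrite gE.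
have E0 : \sum_s \sum_t mu s * H s t * (g s - g t) ^+ 2 = 0.
  transitivity (\sum_s \sum_t mu s * H s t * g s ^+ 2 +
    \sum_s \sum_t mu s * H s t * g t ^+ 2 -
    (\sum_s \sum_t mu s * H s t * (g s * g t)) *+ 2); last first.
    by rewrite E1 E2 E3 mulr2n subrr.
  rewrite -sumrMnl -big_split -sumrB; apply: eq_bigr => s _ /=.
  rewrite -sumrMnl -big_split -sumrB; apply: eq_bigr => t _ /=.
  by ring.
have ge0 s t : 0 <= mu s * H s t * (g s - g t) ^+ 2.
  apply: mulr_ge0 (sqr_ge0 _); apply: mulr_ge0 (Hs.1 _ _); exact: ltW.
move=> s t hst; apply/eqP; rewrite -subr_eq0.
have/eqP := E0; rewrite psumr_eq0; last by move=> u _; apply: sumr_ge0.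
move=> /allP/(_ s); rewrite mem_index_enum => /(_ isT) /=.
rewrite psumr_eq0 // => /allP/(_ t); rewrite mem_index_enum => /(_ isT) /=.
by rewrite mulf_eq0 sqrf_eq0 mulf_eq0 (negPf (lt0r_neq0 (mu_gt0 s))) (negPf hst).
Qed.

End Gap.

(** * Cluster sums *)

Section Components.
Variables (V E : finType) (ends : E -> V * V).

Lemma adjA_csym (A : {set E}) : connect_sym (adjA ends A).
Proof.
apply: sym_connect_sym => x y; apply: eq_existsb => e /=.
by rewrite orbC.
Qed.

(** A path can be shortened so as to use the new edge at most once, in one of its two directions.
    The induction appends the last edge of the path. *)
Lemma connect_adjAU1 (A : {set E}) e a b (x := (ends e).1) (y := (ends e).2) :
  connect (adjA ends (e |: A)) a b ->
  [|| connect (adjA ends A) a b,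
      connect (adjA ends A) a x && connect (adjA ends A) y b |
      connect (adjA ends A) a y && connect (adjA ends A) x b].
Proof.
set c := connect (adjA ends A).
have cs u v : c u v = c v u by exact: adjA_csym.
have ct u v z : c u v -> c v z -> c u z by exact: connect_trans.
move=> /connectP [p]; elim/last_ind: p b => [|p z IH] b /=.
  by move=> _ ->; rewrite /c connect0.
rewrite rcons_path last_rcons => /andP [pp /exists_inP [f fA fE]] ->.
move: (last a p) pp fE IH => u pp fE /(_ u pp erefl) IH.
move: fA; rewrite in_setU1 => /orP [/eqP fe | fA].
  rewrite fe in fE.
  have {fE} : (x = u /\ y = z) \/ (x = z /\ y = u).
    by rewrite /x /y; case/orP: fE => /eqP ->; [left|right].
  have cxx : c x x by exact: connect0.
  have cyy : c y y by exact: connect0.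
  case=> -[E1 E2]; rewrite -?E1 -?E2 in IH *; case/or3P: IH.
  - by move=> ->; rewrite cyy orbT.
  - by case/andP=> -> _; rewrite cyy orbT.
  - by case/andP=> -> _.
  - by move=> ->; rewrite cxx !orbT.
  - by case/andP=> -> _.
  - by case/andP=> -> _; rewrite cxx !orbT.
have cuz : c u z by apply/connect1/exists_inP; exists f.
case/or3P: IH.
- by move=> h; rewrite (ct _ _ _ h cuz).
- by case/andP=> -> h; rewrite (ct _ _ _ h cuz) orbT.
- by case/andP=> -> h; rewrite (ct _ _ _ h cuz) !orbT.
Qed.

(** Only the components of the endvertices of [e] can merge: once the root of the component of [x]
    is discarded, [r'] is injective on the remaining roots. *)
Lemma ncompU1 (A : {set E}) e : (ncomp ends A <= (ncomp ends (e |: A)).+1)%N.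
Proof.
set x := (ends e).1; set y := (ends e).2.
set r := fingraph.root (adjA ends A).
set r' := fingraph.root (adjA ends (e |: A)).
have cs := adjA_csym A; have cs' := adjA_csym (e |: A).
rewrite /ncomp /n_comp_mem.
set P := (X in (#|X| <= _)%N); set P' := (X in (_ <= #|X|.+1)%N).
apply: (@leq_trans #|[predD1 P & r x]|.+1).
  by rewrite (cardD1 (r x) P) addnC -addn1 leq_add2l leq_b1.
rewrite ltnS -(@card_in_image _ _ r').
  apply: subset_leq_card; apply/subsetP => u /imageP [v _ ->].
  by rewrite inE /= roots_root.
have rP u : u \in [predD1 P & r x] -> r u = u /\ r u <> r x.
  rewrite !inE /= => /and3P [ux /eqP ru _].
  by rewrite -/r in ru; rewrite ru; split=> //; apply/eqP.
move=> a b /rP [ra nax] /rP [rb nbx] /(fingraph.rootP cs') /connect_adjAU1.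
case/or3P => [|/andP [h _]|/andP [_ h]].
- by move/(fingraph.rootP cs); rewrite -/r ra rb.
- by case: nax; apply/(fingraph.rootP cs).
- by case: nbx; apply/esym/(fingraph.rootP cs).
Qed.

(** Such a colouring is constant on the components of [A], so it amounts to a free choice of colours
    at their roots. *)
Lemma card_monochromatic (q : nat) (A : {set E}) : (0 < q)%N ->
  #|[set t : conf V q | A \subset Emono ends t]| = (q ^ ncomp ends A)%N.
Proof.
move=> q0; have cs := adjA_csym A.
set r := fingraph.root (adjA ends A).
pose c0 : 'I_q := Ordinal q0.
pose P := predI (roots (adjA ends A)) (mem [pred x : V | true]).
have -> : (q ^ ncomp ends A = #|pffun_on c0 P 'I_q|)%N.
  by rewrite card_pffun_on card_ord.
(* [g] keeps the colours at the roots and puts the default [c0] elsewhere; [g'] spreads the root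
   colours over the components. *)
pose g (t : conf V q) : conf V q := [ffun v => if v \in P then t v else c0].
pose g' (t : conf V q) : conf V q := [ffun v => t (r v)].
have inP v : (v \in P) = (r v == v) by rewrite !inE andbT.
have tr (t : conf V q) : A \subset Emono ends t -> forall v, t (r v) = t v.
  move=> /subsetP At v.
  have : connect (adjA ends A) v (r v) by exact: connect_root.
  have cl : closed (adjA ends A) [pred u | t u == t v].
    apply: (intro_closed cs) => a b /exists_inP [e /At]; rewrite !inE => te.
    by case/orP=> /eqP h; move: te; rewrite h /= => /eqP ->.
  by move/(closed_connect cl); rewrite !inE eqxx => /esym/eqP.
rewrite -(@card_in_imset _ _ g); last first.
  move=> t u; rewrite !inE => /tr Ht /tr Hu /ffunP gE.
  apply/ffunP => v; have := gE (r v).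
  by rewrite !ffunE inP /r root_root // eqxx -/r Ht Hu.
apply: eq_card => f; apply/imsetP/pffun_onP => [[t _ ->]|[fP _]].
  split=> //; apply/supportP => v /negPf vP; by rewrite ffunE vP.
exists (g' f).
  rewrite inE; apply/subsetP => e eA; rewrite inE !ffunE; apply/eqP; congr (f _).
  apply/(fingraph.rootP cs)/connect1/exists_inP; exists e => //.
  by rewrite -surjective_pairing eqxx.
apply/ffunP => v; rewrite !ffunE inP.
case: eqP => [-> //|/eqP vr].
by apply: (supportP fP); rewrite inP.
Qed.

End Components.

Lemma sum_subsetU1 (R : nmodType) (E : finType) (g : {set E} -> R) (e : E) (F : {set E}) :
  e \notin F ->
  \sum_(A : {set E} | A \subset e |: F) g A =
  \sum_(A : {set E} | A \subset F) (g A + g (e |: A)).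
Proof.
move=> eF; rewrite big_split /= (bigID (fun A : {set E} => e \in A)) /= addrC.
congr (_ + _).
  apply: eq_bigl => A; apply/andP/idP => [[/subsetP AF eA]|AF].
    apply/subsetP => f fA; have := AF f fA; rewrite in_setU1 => /orP[/eqP fe|//].
    by rewrite -fe fA in eA.
  split; first by apply: (subset_trans AF); exact: subsetUr.
  by apply: contra eF; apply: (subsetP AF).
rewrite (reindex_onto (fun B => e |: B) (fun A => A :\ e)) /=; last first.
  by move=> A /andP [_ eA]; rewrite setD1K.
apply: eq_bigl => B; rewrite setU11 andbT; apply/andP/idP => [[BF /eqP BE]|BF].
  have eB : e \notin B by rewrite -BE !inE eqxx.
  apply/subsetP => f fB; have := subsetP BF f; rewrite !in_setU1 fB orbT => /(_ isT).
  by case/orP=> // /eqP fe; rewrite -fe fB in eB.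
split; first exact: setUS.
rewrite setU1K //; by apply: contra eF; apply: (subsetP BF).
Qed.

Lemma sum_subset_expr (R : comNzRingType) (E : finType) (r : R) (F : {set E}) :
  \sum_(A : {set E} | A \subset F) r ^+ #|A| = (1 + r) ^+ #|F|.
Proof.
move: {2}#|F| (erefl #|F|) => n; elim: n F => [|n IH] F Fn.
  have -> : F = set0 by apply/eqP; rewrite -cards_eq0 Fn.
  under eq_bigl => A do rewrite subset0.
  by rewrite big_pred1_eq cards0.
have [e eF] : exists e, e \in F by apply/card_gt0P; rewrite Fn.
have Fn' : #|F :\ e| = n by have := cardsD1 e F; rewrite Fn eF => -[].
rewrite -[in LHS](setD1K eF) sum_subsetU1 ?setD11 //.
rewrite Fn exprS -{1}Fn' -IH // mulr_sumr; apply: eq_bigr => A AF.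
rewrite cardsU1; have -> : e \notin A.
  by apply/negP => /(subsetP AF); rewrite setD11.
by rewrite exprS mulrDl mul1r.
Qed.

Section ClusterSum.
Variables (R : realFieldType) (V E : finType) (ends : E -> V * V).
Variables (q : nat) (r : R).
Hypotheses (q_gt0 : (0 < q)%N) (r_ge0 : 0 <= r).

(** A random-cluster partition function on the edges [F], with edge weight [r] and cluster weight
    [q^-1]. *)
Definition cluster_sum (F : {set E}) : R :=
  \sum_(A : {set E} | A \subset F) r ^+ #|A| * q%:R ^- ncomp ends A.

Let q0 : 0 < q%:R :> R. Proof. by rewrite ltr0n. Qed.

Let term_ge0 (A : {set E}) : 0 <= r ^+ #|A| * q%:R ^- ncomp ends A.
Proof. by rewrite mulr_ge0 ?invr_ge0 ?exprn_ge0 // ltW. Qed.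

Lemma cluster_sum_ge0 F : 0 <= cluster_sum F.
Proof. exact: sumr_ge0. Qed.

Lemma cluster_sum_subset (F G : {set E}) : F \subset G -> cluster_sum F <= cluster_sum G.
Proof.
move=> FG; rewrite /cluster_sum [leRHS](bigID (fun A : {set E} => A \subset F)) /=.
have -> : \sum_(A : {set E} | (A \subset G) && (A \subset F))
    r ^+ #|A| * q%:R ^- ncomp ends A
   = cluster_sum F.
  by apply: eq_bigl => A; apply: andb_idl => /subset_trans; apply.
by rewrite lerDl; apply: sumr_ge0.
Qed.

(** Pair each [A] avoiding [e] with [e |: A]: the new edge contributes a factor [r], and losing at
    most one component gains at most [q]. *)
Lemma cluster_sumU1 (e : E) (F : {set E}) : e \notin F ->
  cluster_sum (e |: F) <= (1 + r * q%:R) * cluster_sum F.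
Proof.
move=> eF; rewrite /cluster_sum sum_subsetU1 // mulr_sumr; apply: ler_sum => A AF.
rewrite mulrDl mul1r lerD2l cardsU1.
have -> : e \notin A by apply: contra eF; apply: (subsetP AF).
rewrite exprS -!mulrA; apply: ler_wpM2l => //.
rewrite mulrCA; apply: ler_wpM2l; first exact: exprn_ge0.
rewrite -ler_pdivrMl // -invfM -exprS lef_pV2 ?posrE ?exprn_gt0 //.
by apply: ler_weXn2l; rewrite ?ler1n // ncompU1.
Qed.

(** Edges of [F] outside [G] are removed one at a time, each for one factor; what is left lies in
    [G], where monotonicity applies. *)
Lemma cluster_sum_le (F G : {set E}) :
  cluster_sum F <= (1 + r * q%:R) ^+ #|F :\: G| * cluster_sum G.
Proof.
move: {2}#|F :\: G| (erefl #|F :\: G|) => n; elim: n F => [|n IH] F Fn.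
  rewrite Fn mul1r; apply: cluster_sum_subset.
  by rewrite -setD_eq0 -cards_eq0 Fn.
have [e eF] : exists e, e \in F :\: G by apply/card_gt0P; rewrite Fn.
have EF : (F :\ e) :\: G = (F :\: G) :\ e by rewrite setDDl setUC -setDDl.
have Fn' : #|(F :\ e) :\: G| = n.
  by rewrite EF; have := cardsD1 e (F :\: G); rewrite Fn eF => -[].
have eF' : e \in F by case/setDP: eF.
rewrite -[in leLHS](setD1K eF').
apply: (le_trans (cluster_sumU1 _)); first by rewrite setD11.
rewrite Fn exprS -mulrA -{1}Fn'; apply: ler_wpM2l; last exact: IH.
by rewrite addr_ge0 // mulr_ge0 // ltW.
Qed.

End ClusterSum.

(** * Potts model *)

Section PottsDynamics.
Variables (R : realType) (V E : finType) (ends : E -> V * V).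
Variables (q : nat) (beta : R) (w : V) (c1 : 'I_q).
Hypothesis beta_ge0 : 0 <= beta.

Let q_gt0 : (0 < q)%N. Proof. exact: leq_ltn_trans (ltn_ord c1). Qed.
Let qR_gt0 : 0 < q%:R :> R. Proof. by rewrite ltr0n. Qed.
Let r : R := expR beta - 1.
Let r_ge0 : 0 <= r. Proof. by rewrite subr_ge0 -expR0 ler_expR. Qed.

Local Notation Em := (Emono ends).
Local Notation W := (weight ends beta).
Local Notation Z := (Zpart ends q beta).
Local Notation psw := (PSW ends (q:=q) beta).
Local Notation piw := (piw ends beta).
Local Notation L := (Lam w c1).
Local Notation CS := (cluster_sum ends q r).

Lemma weight_gt0 (s : conf V q) : 0 < W s.
Proof. exact: expR_gt0. Qed.

Lemma weightE (s : conf V q) : W s = expR beta ^+ #|Em s|.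
Proof. by rewrite /weight expRM_natr. Qed.

Lemma Zpart_gt0 : 0 < Z.
Proof.
rewrite /Zpart (bigD1 [ffun=> c1]) //= ltr_pwDl ?weight_gt0 //.
by apply: sumr_ge0 => s _; exact: ltW (weight_gt0 s).
Qed.

Lemma piwE (s : conf V q) : piw s = q%:R / Z * W s.
Proof. by rewrite /Defs.piw /piP mulrA mulrAC. Qed.

Lemma piw_gt0 (s : conf V q) : 0 < piw s.
Proof. by rewrite piwE mulr_gt0 ?divr_gt0 ?Zpart_gt0 ?weight_gt0. Qed.

(** Since [1 - p = e^-beta], the prefactor is the reciprocal weight and [p / (1 - p) = r]. Detailed
    balance can be read off, the remaining sum being symmetric in [s] and [t]. *)
Lemma PSWE (s t : conf V q) : psw s t = (W s)^-1 * CS (Em s :&: Em t).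
Proof.
have E1 : 1 - pSW beta = (expR beta)^-1.
  by rewrite /pSW opprB addrC subrK expRN.
have E2 : pSW beta / (1 - pSW beta) = r.
  by rewrite E1 invrK /pSW expRN mulrBl mul1r mulVf // gt_eqF ?expR_gt0.
by rewrite /PSW E2 E1 exprVn -weightE.
Qed.

Lemma weight_PSW_sym (s t : conf V q) : W s * psw s t = W t * psw t s.
Proof. by rewrite !PSWE !mulVKf ?gt_eqF ?weight_gt0 // setIC. Qed.

Lemma PSW_ge0 (s t : conf V q) : 0 <= psw s t.
Proof.
by rewrite PSWE mulr_ge0 ?cluster_sum_ge0 // invr_ge0 ltW // weight_gt0.
Qed.

(** After exchanging the sums, the [q ^ ncomp A] configurations compatible with [A] cancel
    [q ^- ncomp A]; the binomial theorem then yields [(1 + r) ^+ #|Em s|], which is [W s]. *)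
Lemma PSW_row (s : conf V q) : \sum_t psw s t = 1.
Proof.
under eq_bigr => t _ do rewrite PSWE.
rewrite -mulr_sumr; apply: (mulfI (lt0r_neq0 (weight_gt0 s))).
rewrite mulVKf ?gt_eqF ?weight_gt0 // mulr1.
transitivity (\sum_(A : {set E} | A \subset Em s) r ^+ #|A|); last first.
  by rewrite sum_subset_expr /r addrC subrK weightE.
rewrite /cluster_sum.
transitivity (\sum_(t : conf V q) \sum_(A : {set E} | A \subset Em s)
   (if A \subset Em t then r ^+ #|A| * q%:R ^- ncomp ends A else 0)).
  apply: eq_bigr => t _; rewrite -big_mkcondr; apply: eq_bigl => A.
  by rewrite subsetI.
rewrite exchange_big; apply: eq_bigr => A _ /=.
rewrite -big_mkcond sumr_const.
have -> : #|[pred t : conf V q | A \subset Em t]| = (q ^ ncomp ends A)%N.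
  rewrite -card_monochromatic //; apply: eq_card => t; by rewrite !inE.
by rewrite -[LHS]mulr_natr natrX divfK // expf_neq0 // gt_eqF.
Qed.

Lemma Emono_perm (p : {perm 'I_q}) (t : conf V q) :
  Em [ffun v => p (t v)] = Em t.
Proof. by apply/setP => e; rewrite !inE !ffunE (inj_eq perm_inj). Qed.

(* Each colour class [{t | t w = k}] is mapped onto [Lam w c1] by swapping the
   colours [k] and [c1]. *)
Lemma sum_conf_Lam (F : conf V q -> R) :
  (forall s t, Em s = Em t -> F s = F t) ->
  \sum_t F t = q%:R * \sum_(t : L) F (val t).
Proof.
move=> FE; rewrite (partition_big (fun t : conf V q => t w) predT) //=.
rewrite -(big_sub [pred t : conf V q | t w == c1] F).
transitivity (\sum_(k < q) \sum_(t : conf V q | t w == c1) F t); last first.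
  by rewrite sumr_const card_ord mulr_natl.
apply: eq_bigr => k _.
pose h (t : conf V q) : conf V q := [ffun v => tperm k c1 (t v)].
have hK : involutive h by move=> t; apply/ffunP => v; rewrite !ffunE tpermK.
rewrite (reindex_inj (inv_inj hK)); apply: eq_big => [t|t _].
  by rewrite ffunE -(inj_eq (@perm_inj _ (tperm k c1))) tpermK tpermL.
by apply: FE; rewrite Emono_perm.
Qed.

(** * Swendsen--Wang and heat bath with the colour of [w] fixed *)

Definition piLam (s : L) : R := piw (val s).
(** One Swendsen--Wang step followed by swapping the new colour of [w] with [c1]; the [q] possible
    colours contribute equally, whence the factor [q]. *)
Definition fixedSW (s t : L) : R := q%:R * psw (val s) (val t).
Definition fixedHB (s t : L) : R := PHB ends beta w (val s) (val t).

Lemma piLam_gt0 s : 0 < piLam s. Proof. exact: piw_gt0. Qed.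

Lemma PSW_Emono (s t s' t' : conf V q) : Em s = Em s' -> Em t = Em t' ->
  psw s t = psw s' t'.
Proof. by move=> es et; rewrite !PSWE !weightE es et. Qed.

Lemma fixedSW_stochastic : stochastic fixedSW.
Proof.
split=> [s t|s]; first by rewrite mulr_ge0 ?PSW_ge0 // ltW.
rewrite /fixedSW -mulr_sumr -(sum_conf_Lam (F := psw (val s))) ?PSW_row //.
by move=> t t' E'; exact: PSW_Emono.
Qed.

Lemma fixedSW_reversible : reversible piLam fixedSW.
Proof.
move=> s t; rewrite /fixedSW /piLam !piwE.
transitivity (q%:R / Z * q%:R * (W (val s) * psw (val s) (val t))); first by ring.
by rewrite weight_PSW_sym; ring.
Qed.

Lemma upd_id (s : conf V q) v : upd s v (s v) = s.
Proof. by apply/ffunP => u; rewrite ffunE; case: eqP => // ->. Qed.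

Lemma upd_upd (s : conf V q) v l k : upd (upd s v l) v k = upd s v k.
Proof. by apply/ffunP => u; rewrite !ffunE; case: eqP. Qed.

Lemma inOmP (s t : conf V q) v : reflect (exists l, t = upd s v l) (inOm s v t).
Proof. exact: 'exists_eqP. Qed.

Lemma inOm_sym (s t : conf V q) v : inOm s v t -> inOm t v s.
Proof.
case/inOmP => l ->; apply/inOmP; exists (s v).
by rewrite upd_upd upd_id.
Qed.

Lemma upd_Lam (s : L) v l : v != w -> upd (val s) v l w == c1.
Proof.
move=> vw; rewrite ffunE; case: (w =P v) => [wv|_]; last exact: (valP s).
by rewrite wv eqxx in vw.
Qed.

Lemma sum_inOm (G : conf V q -> R) (s : L) v : v != w ->
  \sum_(t : L) G (val t) * (inOm (val s) v (val t))%:R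
  = \sum_l G (upd (val s) v l).
Proof.
move=> vw; rewrite -(big_sub [pred t : conf V q | t w == c1]
  (fun t => G t * (inOm (val s) v t)%:R)).
transitivity (\sum_(t : conf V q | (t w == c1) && inOm (val s) v t) G t).
  rewrite [RHS]big_mkcondr; apply: eq_bigr => t _.
  by case: inOm; rewrite ?mulr1 ?mulr0.
rewrite (reindex_onto (fun l => upd (val s) v l) (fun t : conf V q => t v)) /=.
  apply: eq_bigl => l; rewrite upd_Lam // ffunE eqxx eqxx andbT /=.
  by apply/inOmP; exists l.
by move=> t /andP [_ /inOmP [l ->]]; rewrite ffunE eqxx.
Qed.

Lemma heat_bath_norm_gt0 (s : conf V q) v : 0 < \sum_l piw (upd s v l).
Proof.
rewrite (bigD1 c1) //= ltr_pwDl ?piw_gt0 //.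
by apply: sumr_ge0 => l _; exact: ltW (piw_gt0 _).
Qed.

Lemma PHB_term_ge0 (s t : conf V q) v :
  0 <= piw t / (\sum_l piw (upd s v l)) * (inOm s v t)%:R.
Proof.
rewrite mulr_ge0 ?ler0n // divr_ge0 // ltW //; [exact: piw_gt0|exact: heat_bath_norm_gt0].
Qed.

(** With a single vertex the normalising factor would be the inverse of 0, which is 0, and the rows
    would vanish. *)
Lemma fixedHB_stochastic : (1 < #|V|)%N -> stochastic fixedHB.
Proof.
move=> V1; split=> [s t|s].
  rewrite /fixedHB /PHB mulr_ge0 ?invr_ge0 ?ler0n //.
  by apply: sumr_ge0 => v _; exact: PHB_term_ge0.
rewrite /fixedHB /PHB -mulr_sumr exchange_big /=.
under eq_bigr => v vw.
  rewrite (sum_inOm (fun t => piw t / \sum_l piw (upd (val s) v l))) //.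
  rewrite -mulr_suml divff ?gt_eqF ?heat_bath_norm_gt0 //.
  over.
rewrite sumr_const cardC1 -subn1 mulVf //.
by rewrite pnatr_eq0 -lt0n subn_gt0.
Qed.

Lemma fixedHB_reversible : reversible piLam fixedHB.
Proof.
move=> s t; rewrite /fixedHB /PHB /piLam mulrCA [RHS]mulrCA; congr (_ * _).
rewrite !mulr_sumr; apply: eq_bigr => v _.
case h : (inOm (val s) v (val t)); last first.
  case h' : (inOm (val t) v (val s)); last by rewrite !mulr0.
  by rewrite (inOm_sym h') in h.
rewrite (inOm_sym h); case/inOmP: h => l ->.
under [in RHS]eq_bigr => k _ do rewrite upd_upd.
by ring.
Qed.

Lemma fixedHB_neq0 (s t : L) : fixedHB s t != 0 ->
  exists v l, v != w /\ val t = upd (val s) v l.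
Proof.
rewrite /fixedHB /PHB; apply: contraPP => /forallNP H; apply/negP; rewrite negbK.
rewrite big1 ?mulr0 // => v vw.
case: inOmP => [[l E']|_]; last by rewrite mulr0.
by case: (H v); exists l.
Qed.

Lemma fixedHB_upd_neq0 (s t : L) v l : (1 < #|V|)%N -> v != w ->
  val t = upd (val s) v l -> fixedHB s t != 0.
Proof.
move=> V1 vw tE; rewrite /fixedHB /PHB mulf_neq0 //.
  by rewrite invr_eq0 pnatr_eq0 -lt0n subn_gt0.
rewrite gt_eqF // (bigD1 v) //= ltr_pwDl //.
  have -> : inOm (val s) v (val t) by apply/inOmP; exists l.
  by rewrite mulr1 divr_gt0 ?piw_gt0 ?heat_bath_norm_gt0.
by apply: sumr_ge0 => u _; exact: PHB_term_ge0.
Qed.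

(** The vertices where [s] and [t] disagree are recoloured one by one. They never include [w], so
    each change is a heat-bath step of positive probability, along which [g] is constant. *)
Lemma fixedHB_irreducible : (1 < #|V|)%N ->
  forall g, (forall s, kernel_app fixedHB g s = g s) -> forall s t, g s = g t.
Proof.
move=> V1 g gE s t.
have along := harmonic_constant_along piLam_gt0 (fixedHB_stochastic V1)
  fixedHB_reversible gE.
move: {2}#|_| (erefl #|[set v | val s v != val t v]|) => n.
elim: n s => [|n IH] s Hn.
  congr (g _); apply: val_inj; apply/ffunP => v; apply/eqP.
  apply/negPn/negP => h; move/eqP: Hn; rewrite cards_eq0 => /eqP/setP/(_ v).
  by rewrite !inE h.
have [v vD] : exists v, v \in [set v | val s v != val t v].
  by apply/card_gt0P; rewrite Hn.
have vst : val s v != val t v by move: vD; rewrite inE.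
have vw : v != w.
  apply: contra vst => /eqP ->.
  by rewrite (eqP (valP s)) (eqP (valP t)).
pose s' : L := exist _ (upd (val s) v (val t v)) (upd_Lam s (val t v) vw).
rewrite (along s s'); last exact: (@fixedHB_upd_neq0 _ _ v (val t v)).
apply: IH; have := cardsD1 v [set v | val s v != val t v].
rewrite Hn vD => -[->]; apply: eq_card => u; rewrite !inE ffunE.
by case: (u =P v) => [->|_]; rewrite ?eqxx.
Qed.

(** * Effect of recolouring one vertex *)

Lemma Emono_upd (s : conf V q) v l :
  Em (upd s v l) :\: Em s \subset [set e | ((ends e).1 == v) || ((ends e).2 == v)].
Proof.
apply/subsetP => e; rewrite !inE !ffunE => /andP [h].
by case: ((ends e).1 =P v) => //= _; case: ((ends e).2 =P v) => //= _ h'; rewrite h' in h.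
Qed.

Lemma Emono_updV (s : conf V q) v l :
  Em s :\: Em (upd s v l) \subset [set e | ((ends e).1 == v) || ((ends e).2 == v)].
Proof. by rewrite -{1}(upd_id s v) -(upd_upd s v l); exact: Emono_upd. Qed.

(* [classical_set_scope] is open in Defs, so the set counted by [deg] is a
   classical set, not the finite set on the right. *)
Lemma degE v :
  deg ends v = #|[set e : E | ((ends e).1 == v) || ((ends e).2 == v)]|.
Proof.
apply: eq_card => e; rewrite [RHS]inE.
by apply/idP/idP => [/set_mem //|h]; apply/mem_set.
Qed.

Lemma deg_le_Delta v : v != w -> (deg ends v <= Delta_t ends w)%N.
Proof. by move=> vw; rewrite /Delta_t (bigD1 v) //= leq_maxl. Qed.

(** Only edges at [v] can cease to be monochromatic, at most [Delta_t] of them, each worth a factor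
    [e^beta]. The density contains reciprocal weights, so the old weight has to be bounded by the
    new one. *)
Lemma weight_upd (s : conf V q) v l : v != w ->
  W s <= expR beta ^+ Delta_t ends w * W (upd s v l).
Proof.
move=> vw; rewrite !weightE -exprD; apply: ler_weXn2l; first by rewrite -expR0 ler_expR.
rewrite -(cardsID (Em (upd s v l)) (Em s)) addnC leq_add //.
  apply: leq_trans (deg_le_Delta vw); rewrite degE.
  exact: subset_leq_card (Emono_updV _ _ _).
by apply: subset_leq_card; exact: subsetIr.
Qed.

Lemma cluster_factor : 1 + r * q%:R <= q%:R * expR beta.
Proof.
rewrite /r; have : 1 <= q%:R :> R by rewrite ler1n.
by set b := expR beta; move=> h; lra.
Qed.

(** An edge entering the intersection became monochromatic in one of the two configurations, so it
    is incident to [u] or [v]; each such edge costs at most [q e^beta]. *)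
Lemma cluster_sum_upd (s t : conf V q) u l v k : u != w -> v != w ->
  CS (Em (upd s u l) :&: Em (upd t v k))
   <= (q%:R * expR beta) ^+ (2 * Delta_t ends w) * CS (Em s :&: Em t).
Proof.
move=> uw vw; apply: (le_trans (cluster_sum_le _ q_gt0 r_ge0 _ (Em s :&: Em t))).
apply: ler_wpM2r; first exact: cluster_sum_ge0.
have c0 : 0 <= 1 + r * q%:R by rewrite addr_ge0 // mulr_ge0 // ltW.
have c1' : 1 <= q%:R * expR beta by rewrite
  (le_trans _ cluster_factor) // lerDl mulr_ge0 // ltW.
apply: (le_trans (lerXn2r _ _ _ cluster_factor)) => //.
  by rewrite nnegrE (le_trans _ c1').
apply: ler_weXn2l => //; rewrite mul2n -addnn.
apply: (@leq_trans #|(Em (upd s u l) :\: Em s) :|: (Em (upd t v k) :\: Em t)|).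
  apply: subset_leq_card; apply/subsetP => e; rewrite !inE negb_and.
  by case/andP=> /orP [->|->] /andP [-> ->]; rewrite ?orbT.
apply: (leq_trans (leq_card_setU _ _)); apply: leq_add.
  apply: leq_trans (deg_le_Delta uw); rewrite degE.
  exact: subset_leq_card (Emono_upd _ _ _).
apply: leq_trans (deg_le_Delta vw); rewrite degE.
exact: subset_leq_card (Emono_upd _ _ _).
Qed.

(** With [D] for [Delta_t], this splits into [(q e^beta)^(2 D)] for the cluster sum and [e^(beta D)]
    for each of the two weights. *)
Definition density_const : R := (q%:R * expR (2 * beta)) ^+ (2 * Delta_t ends w).

Lemma density_const_ge1 : 1 <= density_const.
Proof.
apply: exprn_ege1; rewrite -[leLHS]mulr1; apply: ler_pM; rewrite ?ler01 ?ler1n //.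
by rewrite -[leLHS]expR0 ler_expR mulr_ge0.
Qed.

Lemma fixedSW_densityE (s t : L) :
  fixedSW s t / piLam t =
  Z * ((W (val s))^-1 * (W (val t))^-1 * CS (Em (val s) :&: Em (val t))).
Proof.
rewrite /fixedSW /piLam PSWE piwE; field.
by rewrite !gt_eqF ?weight_gt0 ?Zpart_gt0.
Qed.

Lemma fixedSW_density_le (s s' t t' : L) : fixedHB s s' != 0 -> fixedHB t t' != 0 ->
  fixedSW s' t' / piLam t' <= density_const * (fixedSW s t / piLam t).
Proof.
move=> /fixedHB_neq0 [u [l [uw sE]]] /fixedHB_neq0 [v [k [vw tE]]].
rewrite !fixedSW_densityE [leRHS]mulrCA; apply: ler_wpM2l; first exact: ltW Zpart_gt0.
have := weight_upd (val s) l uw; have := weight_upd (val t) k vw.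
have := cluster_sum_upd (val s) (val t) l k uw vw.
rewrite sE tE; set D := Delta_t ends w.
have -> : density_const =
    (q%:R * expR beta) ^+ (2 * D) * (expR beta ^+ D * expR beta ^+ D).
  rewrite /density_const -/D -exprD addnn -mul2n -exprMn -mulrA -expRD.
  by rewrite -[2]/(1 + 1) mulrDl !mul1r.
set A := CS _; set B := CS _; set b := expR beta ^+ D.
have b0 : 0 < b by rewrite exprn_gt0 // expR_gt0.
have A0 : 0 <= A by exact: cluster_sum_ge0.
move=> h; set P := W (upd (val s) u l); set Q := W (upd (val t) v k).
set P1 := W (val s); set Q1 := W (val t).
have P0 : 0 < P by exact: weight_gt0.
have Q0 : 0 < Q by exact: weight_gt0.
have P10 : 0 < P1 by exact: weight_gt0.
have Q10 : 0 < Q1 by exact: weight_gt0.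
have inv_le x y : 0 < x -> 0 < y -> x <= b * y -> y^-1 <= b * x^-1.
  move=> x0 y0 xy; rewrite -[y^-1]mul1r ler_pdivrMr //.
  by rewrite mulrAC ler_pdivlMr // mul1r.
move=> /(inv_le _ _ Q10 Q0) hQ /(inv_le _ _ P10 P0) hP.
set c := (_ * _) ^+ _ in h *.
have -> : c * (b * b) * (P1^-1 * Q1^-1 * B) = (b * P1^-1 * (b * Q1^-1)) * (c * B) by ring.
have Pi0 : 0 <= P^-1 by rewrite invr_ge0 ltW.
have Qi0 : 0 <= Q^-1 by rewrite invr_ge0 ltW.
by apply: ler_pM => //; [exact: mulr_ge0|exact: ler_pM].
Qed.

(** As [x] is nonzero, [f] inherits from [kernel_app psw f] the dependence on [Em] alone, so sums
    over all configurations collapse to [Lam]. Mean zero follows from stationarity and [x != 1]. *)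
Lemma PSW_eigenfunction_Lam (x : R) (f : conf V q -> R) :
  (exists s, f s != 0) -> (forall s, kernel_app psw f s = x * f s) ->
  x != 0 -> x != 1 ->
  let g (s : L) := f (val s) in
  [/\ exists s, g s != 0, \sum_s piLam s * g s = 0
    & forall s, kernel_app fixedSW g s = x * g s].
Proof.
move=> [s fs] fE x0 x1 g.
have fEm s1 s2 : Em s1 = Em s2 -> f s1 = f s2.
  move=> es; apply: (mulfI x0); rewrite -!fE; apply: eq_bigr => t _.
  by rewrite (PSW_Emono es (erefl (Em t))).
split.
(* Swapping colours moves a point where [f] is nonzero into [Lam] without changing the value of
   [f]. *)
- pose s' : conf V q := [ffun v => tperm (s w) c1 (s v)].
  have s'w : s' w == c1 by rewrite ffunE tpermL.
  by exists (exist _ s' s'w); rewrite /g /= (fEm _ s) // Emono_perm.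
- have W0 : \sum_s weight ends beta s * f s = 0.
    have sumK : \sum_s weight ends beta s * kernel_app psw f s
        = \sum_s weight ends beta s * f s.
      have := kernel_app_adjoint weight_PSW_sym f (fun=> 1).
      under eq_bigr => t _ do rewrite mul1r.
      move=> ->; apply: eq_bigr => t _; congr (_ * _).
      rewrite /kernel_app; under eq_bigr => u _ do rewrite mulr1.
      by rewrite PSW_row // mulr1.
    move: sumK; under eq_bigr => t _ do rewrite fE mulrCA.
    rewrite -mulr_sumr => /eqP; rewrite -subr_eq0 -{2}[\sum_s _]mul1r -mulrBl.
    by rewrite mulf_eq0 subr_eq0 (negPf x1) => /eqP.
  apply/eqP; rewrite -(mulrI_eq0 _ (mulfI (lt0r_neq0 Zpart_gt0))).
  rewrite -[X in _ == X]W0 sum_conf_Lam; last first.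
    by move=> t u e; rewrite !weightE e (fEm t u).
  rewrite !mulr_sumr; apply/eqP; apply: eq_bigr => t _.
  rewrite /piLam piwE /g; set a := f _; set b := W _; field.
  rewrite gt_eqF //; exact: Zpart_gt0.
- move=> t; rewrite -[RHS]fE /kernel_app.
  rewrite sum_conf_Lam; last first.
    move=> u v e; rewrite (fEm u v e).
    by rewrite (PSW_Emono (erefl (Em (val t))) e).
  by rewrite mulr_sumr; apply: eq_bigr => u _; rewrite /fixedSW /g -mulrA.
Qed.

(** With one vertex [Lam] is a single configuration, on which mean zero means zero. *)
Lemma Lam_mean_zero_card (g : L -> R) :
  (exists s, g s != 0) -> \sum_s piLam s * g s = 0 -> (1 < #|V|)%N.
Proof.
move=> [s gs] mean; rewrite ltnNge; apply/negP => V1.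
have allw v : v = w by apply: (fintype_le1P V1).
have alls t : t = s.
  apply: val_inj; apply/ffunP => v; rewrite (allw v).
  by rewrite (eqP (valP s)) (eqP (valP t)).
move: mean; rewrite (big_pred1 s) => [/eqP|t]; last by rewrite (alls t) /= eqxx.
by rewrite mulf_eq0 (negPf gs) gt_eqF ?piLam_gt0.
Qed.

End PottsDynamics.

Theorem theorem3p9 (R : realType) (V E : finType) (ends : E -> V * V)
  (q : nat) (hq : (0 < q)%N) (beta : R) (hbeta : 0 <= beta) (w : V) :
  sgap (mx_of (PSW ends (q:=q) beta))
  >= c_SW ends q beta w
     * sgap (mx_of (fun s t : Lam w (Ordinal hq) =>
                      PHB ends beta w (val s) (val t))).
Proof.
set c1 := Ordinal hq; set g := sgap _.
pose C : R := density_const ends q beta w.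
have C1 : 1 <= C := density_const_ge1 ends w c1 hbeta.
have C0 : 0 < C by exact: lt_le_trans C1.
have cE : c_SW ends q beta w = q%:R^-1 * C^-1 by [].
have q0 : 0 < q%:R :> R by rewrite ltr0n.
have qi1 : q%:R^-1 <= 1 :> R by rewrite invf_le1 // ler1n.
have Ci1 : C^-1 <= 1 by rewrite invf_le1.
have qi0 : 0 <= q%:R^-1 :> R by rewrite invr_ge0 ltW.
have Ci0 : 0 <= C^-1 by rewrite invr_ge0 ltW.
have cC : c_SW ends q beta w <= C^-1 by rewrite cE ler_piMl.
have c0 : 0 <= c_SW ends q beta w by rewrite cE mulr_ge0.
have g1 : g <= 1 by exact: sgap_le1.
have cg1 : c_SW ends q beta w * g <= 1.
  apply: (@le_trans _ _ (c_SW ends q beta w)); first by rewrite ler_piMr.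
  exact: le_trans Ci1.
apply: sgap_geP => // xi.
move/(reversible_eigenC_real (weight_gt0 ends beta (q := q))
  (weight_PSW_sym ends beta (q := q))).
case=> x [f [-> f0 fE]] x1; rewrite cmod_real.
have {}x1 : x != 1 by apply: contra x1 => /eqP ->.
(* Eigenfunctions for the eigenvalue 0 need not be invariant under colour permutations; for them
   [cg1] is enough. *)
have [->|x0] := eqVneq x 0; first by rewrite normr0 subr_ge0.
have [h0 hmean hE] := PSW_eigenfunction_Lam w c1 f0 fE x0 x1.
have V1 := Lam_mean_zero_card h0 hmean.
have mu0 := piLam_gt0 ends beta (w := w) (c1 := c1).
have Ks := fixedSW_stochastic ends w c1 hbeta.
have Kr := fixedSW_reversible ends beta (w := w) (c1 := c1).
(* If [g] is negative, the target is at least 1. Otherwise [c_SW <= C^-1] may be multiplied by [g],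
   and the comparison applies. *)
have [gge|glt] := leP 0 g; last first.
  apply: (le_trans (stochastic_eigen_le1 mu0 Ks Kr h0 hE)).
  by rewrite lerDl oppr_ge0 mulr_ge0_le0 // ltW.
have := comparison mu0 (fixedHB_stochastic ends beta w c1 V1)
  (fixedHB_reversible ends beta (w := w) (c1 := c1)) Ks Kr (fixedHB_irreducible V1) C1
  (fixedSW_density_le hbeta) h0 hmean hE.
move/le_trans; apply; rewrite lerD2l lerN2.
exact: ler_wpM2r.
Qed.
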